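(* Let $x,y,z$ be real numbers with $0<x<y<z$. Then $$f(x,y,z)>f(y,x,z)>f(z,x,y).$$ In particular, when the three initial stacks are $x,y,z$ (in some order among the players), player 1 is strictly less likely to lose (i.e. to be the first player eliminated) if they swap their initial stack with that of another player who has a larger initial stack.
   Context: Game: three players start with real capitals (stacks) $a,b,c>0$ (players 1, 2, 3 respectively). In each round, independently of the past, one of the three pairs of players is chosen uniformly at random (probability $1/3$ each), and these two players bet on a fair coin toss; the size of the bet is the minimum of their two current stacks. The winner of the toss gains this amount and the other player loses it. Thus from a state with three positive stacks there are 6 possible transitions, each with probability $1/6$. The first player whose stack reaches $0$ is called the loser, and is said to be eliminated first. $f(a,b,c)$ denotes the probability that player 1 is the loser when players 1, 2, 3 have initial stacks $a,b,c$ respectively. By symmetry $f(a,b,c)=f(a,c,b)$. *)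

(* Defs.v *)
From HB Require Import structures.
From mathcomp Require Import all_boot all_order all_algebra.
From mathcomp Require Import finmap.
From mathcomp Require Import all_classical all_reals all_analysis.

Set Implicit Arguments.
Unset Strict Implicit.
Unset Printing Implicit Defensive.

Import Order.TTheory GRing.Theory Num.Theory.
Import numFieldNormedType.Exports.

Local Open Scope classical_set_scope.
Local Open Scope ring_scope.

Section Independence.
Context d (T : measurableType d) (R : realType) (P : probability T R).

Definition mutually_independent (I : choiceType) (F : I -> set (set T)) : Prop :=
  forall (J : {fset I}) (E : I -> set T),
    (forall i, i \in J -> F i (E i)) ->
    P (\bigcap_(i in [set` J]) E i) = (\prod_(i <- J) P (E i))%E.

End Independence.

Section Game.
Context (R : realType).

(* Players 1, 2, 3 are the ordinals 0, 1, 2. *)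
Definition stacks (a b c : R) : 'I_3 -> R := fun j => nth 0 [:: a; b; c] j.

Definition bet (win lose : 'I_3) (s : 'I_3 -> R) : 'I_3 -> R :=
  let m := Num.min (s win) (s lose) in
  fun j => if j == win then s j + m else if j == lose then s j - m else s j.

(* The three pairs of players are {i, i + 1} for i : 'I_3, with addition
   modulo 3; the coin decides which of the two wins. *)
Definition play_round (i : 'I_3) (coin : bool) (s : 'I_3 -> R) : 'I_3 -> R :=
  if coin then bet i (i + 1) s else bet (i + 1) i s.

Section Process.
Context d (T : measurableType d) (P : probability T R).
Context (pair : nat -> T -> 'I_3) (coin : nat -> T -> bool).

(* Independence is required of the whole family
   pair 0, coin 0, pair 1, coin 1, ... *)
Record fair_rounds : Prop := FairRounds {
  measurable_pair : forall n (S : set 'I_3), measurable (pair n @^-1` S);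
  measurable_coin : forall n (S : set bool), measurable (coin n @^-1` S);
  uniform_pair : forall n i, P (pair n @^-1` [set i]) = (3%:R^-1)%:E;
  fair_coin : forall n h, P (coin n @^-1` [set h]) = (2%:R^-1)%:E;
  independent_rounds : mutually_independent P (fun k : nat + nat =>
    match k with
    | inl n => preimage_set_system setT (pair n) setT
    | inr n => preimage_set_system setT (coin n) setT
    end) }.

Fixpoint stack_process (s : 'I_3 -> R) (n : nat) (w : T) : 'I_3 -> R :=
  if n is n'.+1 then play_round (pair n' w) (coin n' w) (stack_process s n' w)
  else s.

(* Only states up to the first one with a zero stack matter here, so the
   continuation of stack_process after the first elimination is irrelevant. *)
Definition is_loser (s : 'I_3 -> R) (j : 'I_3) : set T :=
  [set w | exists n, stack_process s n w j = 0 /\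
    forall k, (k < n)%N -> forall i, 0 < stack_process s k w i].

(* The probability that player 1 is the loser. *)
Definition lose_prob (a b c : R) : \bar R := P (is_loser (stacks a b c) ord0).

End Process.
End Game.

(* Main.v *)
(* Let [F a b c] be the probability that player 1 is the loser and
   [D a b c := F a b c - F b a c]. In the one-step recursion for [D], the
   smaller stack of each pair is wiped out with probability 1/2, so only three
   of the six outcomes leave a value of [D] to be estimated, and the recursion
   halves errors. Suppose that, up to an error [t], [D] is nonnegative for
   [a <= b], and at most 32/75 (resp. 7/15) when moreover [c] is the largest
   (resp. smallest) stack. Expanding the recursion at most twice, according to
   the order of the stacks that occur, gives the same bounds with error [t / 2],
   and even [D a b c > - t / 2] for [a < b]. As [F <= 2 / 3], one can start with
   [t = 2 / 3]; hence the bounds hold for [t = 0], and [D a b c > 0] for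
   [a < b]. The recursion for [F] is the limit of the one for the probability
   to lose within [n] rounds. *)

Require Import Defs.
From HB Require Import structures.
From mathcomp Require Import all_boot all_order all_algebra.
From mathcomp Require Import finmap.
From mathcomp Require Import all_classical all_reals all_analysis.
From mathcomp Require Import lra.

Set Implicit Arguments.
Unset Strict Implicit.
Unset Printing Implicit Defensive.

Import Order.TTheory GRing.Theory Num.Theory.
Import numFieldNormedType.Exports.

Local Open Scope classical_set_scope.
Local Open Scope ring_scope.

(* [D a b c] stands for [f a b c - f b a c]; the three equations are the
   one-step recursion, according to the rank of the third stack [c]. *)
Record ruin_gap (R : realType) (D : R -> R -> R -> R) : Prop := RuinGap {
  gap_anti : forall a b c : R, D b a c = - D a b c;
  gap_ruined : forall b c : R, 0 < b -> 0 < c -> D 0 b c = 1;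
  gap_third_ruined : forall a b : R, 0 < a -> 0 < b -> D a b 0 = 0;
  gap_le : forall a b c : R, 0 < a -> 0 < b -> 0 <= c -> D a b c <= 2 / 3;
  gap_third_max : forall a b c : R, 0 < a -> a <= b -> b <= c ->
    6 * D a b c = 1 + D (2 * a) (b - a) c + D (2 * a) b (c - a)
                    + D a (2 * b) (c - b);
  gap_third_mid : forall a b c : R, 0 < a -> a <= c -> c <= b ->
    6 * D a b c = 2 + D (2 * a) (b - a) c + D (2 * a) b (c - a)
                    + D a (b - c) (2 * c);
  gap_third_min : forall a b c : R, 0 < c -> c <= a -> a <= b ->
    6 * D a b c = 1 + D (2 * a) (b - a) c + D (a - c) b (2 * c)
                    + D a (b - c) (2 * c) }.

(* For [t = 0], the constants 7/15 and 32/75 are the fixed points of the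
   estimates [u = (1 + u + 2/3 + 2/3) / 6] and
   [v = (1 + v + 2/3 + 7/15) / 6]. *)
Record gap_bounds (R : realType) (D : R -> R -> R -> R) (t : R) : Prop :=
  GapBounds {
  gap_lower : forall a b c : R, 0 < a -> a <= b -> 0 < c -> - t <= D a b c;
  gap_upper_third_max : forall a b c : R, 0 < a -> a <= b -> b <= c ->
    D a b c <= 32 / 75 + t;
  gap_upper_third_min : forall a b c : R, 0 < c -> c < a -> a <= b ->
    D a b c <= 7 / 15 + t }.

(** * Bounds on the gap from its recursion *)

Section GapBounds.
Context (R : realType) (D : R -> R -> R -> R) (gapD : ruin_gap D).

Lemma gap_ge (a b c : R) : 0 < a -> 0 < b -> 0 <= c -> - (2 / 3) <= D a b c.
Proof.
by move=> a0 b0 c0; rewrite (gap_anti gapD) lerN2; apply: (gap_le gapD).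
Qed.

Lemma gap_bounds_init : gap_bounds D (2 / 3).
Proof.
split=> a b c h1 h2 h3.
- by apply: gap_ge; lra.
- by have : D a b c <= 2 / 3; [apply: (gap_le gapD)|]; lra.
- by have : D a b c <= 2 / 3; [apply: (gap_le gapD)|]; lra.
Qed.

Section Step.
Context (t : R) (t0 : 0 <= t) (bD : gap_bounds D t).

(** Ties of stacks lead to states with a zero stack. There the gap is 1 if [a = 0] and 0 if [c = 0],
    so the lower bound survives as long as only one of the two vanishes. *)
Let ge0 (a b c : R) : 0 <= a -> a <= b -> 0 < b -> 0 <= c -> 0 < a + c ->
  - t <= D a b c.
Proof.
move=> a0 ab b0 c0 ac0; have t_ge0 := t0.
move: a0; rewrite le_eqVlt => /predU1P[a_eq|a_gt0].
  by move: ac0; rewrite -a_eq add0r => c_gt0; rewrite (gap_ruined gapD); lra.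
move: c0; rewrite le_eqVlt => /predU1P[<-|c_gt0].
  by rewrite (gap_third_ruined gapD); lra.
exact: (gap_lower bD).
Qed.

Let le0 (a b c : R) : 0 <= b -> b <= a -> 0 < a -> 0 <= c -> 0 < b + c ->
  D a b c <= t.
Proof.
by move=> *; rewrite (gap_anti gapD) -[leRHS]opprK lerN2; apply: ge0.
Qed.

Let le23 := gap_le gapD.
Let ge23 := gap_ge.
Let max_le := gap_upper_third_max bD.
Let min_le := gap_upper_third_min bD.

Let max_ge (a b c : R) : 0 < b -> b <= a -> a <= c ->
  - (32 / 75 + t) <= D a b c.
Proof. by move=> *; rewrite (gap_anti gapD) lerN2; apply: max_le. Qed.

Let min_ge (a b c : R) : 0 < c -> c < b -> b <= a -> - (7 / 15 + t) <= D a b c.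
Proof. by move=> *; rewrite (gap_anti gapD) lerN2; apply: min_le. Qed.

Lemma third_min_le (a b c : R) : 0 < c -> c < a -> a <= b ->
  D a b c <= 7 / 15 + t / 2.
Proof.
move=> c0 ca ab; have t_ge0 := t0.
eassert (6 * D a b c = _) as E by (apply: (gap_third_min gapD); lra).
have B2 : D (a - c) b (2 * c) <= 2 / 3 by apply: le23; lra.
have B3 : D a (b - c) (2 * c) <= 2 / 3 by apply: le23; lra.
have B1 : D (2 * a) (b - a) c <= 7 / 15 + t.
  have [h|h] := leP (2 * a) (b - a); first by apply: min_le; lra.
  by have : D (2 * a) (b - a) c <= t; [apply: le0|]; lra.
lra.
Qed.

(** If [b <= 2 * a], two of the three gaps are at most [t]. Otherwise the case [a + b <= c] still
    leaves room, and [c < a + b] is the tight case that determines 32/75. *)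
Lemma third_max_le (a b c : R) : 0 < a -> a <= b -> b <= c ->
  D a b c <= 32 / 75 + t / 2.
Proof.
move=> a0 ab bc; have t_ge0 := t0.
eassert (6 * D a b c = _) as E by (apply: (gap_third_max gapD); lra).
have [ba|ab2] := leP b (2 * a).
  have B1 : D (2 * a) (b - a) c <= t by apply: le0; lra.
  have B2 : D (2 * a) b (c - a) <= t by apply: le0; lra.
  have B3 : D a (2 * b) (c - b) <= 2 / 3 by apply: le23; lra.
  lra.
have B1 : D (2 * a) (b - a) c <= 32 / 75 + t.
  have [h|h] := leP (2 * a) (b - a); first by apply: max_le; lra.
  by have : D (2 * a) (b - a) c <= t; [apply: le0|]; lra.
have [cab|cab] := leP (a + b) c.
  have B2 : D (2 * a) b (c - a) <= 32 / 75 + t by apply: max_le; lra.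
  have B3 : D a (2 * b) (c - b) <= 2 / 3 by apply: le23; lra.
  lra.
have B2 : D (2 * a) b (c - a) <= 2 / 3 by apply: le23; lra.
(* Here [c - b < a], so the third stack is the smallest one, or zero when [b = c]. *)
have B3 : D a (2 * b) (c - b) <= 7 / 15 + t.
  move: bc; rewrite le_eqVlt => /predU1P[<-|bc]; last by apply: min_le; lra.
  by rewrite subrr (gap_third_ruined gapD); lra.
lra.
Qed.

(** The crude bound -2/3 on all three gaps exactly cancels the constant 2, so improving one of them
    suffices: the second if [2 * x <= y], else the third, where [y - z < x]. *)
Lemma third_mid_gt (x y z : R) : 0 < x -> x <= z -> z < y ->
  - (t / 2) < D x y z.
Proof.
move=> x0 xz zy; have t_ge0 := t0.
eassert (6 * D x y z = _) as E by (apply: (gap_third_mid gapD); lra).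
have B1 : - (2 / 3) <= D (2 * x) (y - x) z by apply: ge23; lra.
have [h|h] := leP (2 * x) y.
  have B2 : - t <= D (2 * x) y (z - x) by apply: ge0; lra.
  have B3 : - (2 / 3) <= D x (y - z) (2 * z) by apply: ge23; lra.
  lra.
have B2 : - (2 / 3) <= D (2 * x) y (z - x) by apply: ge23; lra.
have B3 : - (32 / 75 + t) <= D x (y - z) (2 * z) by apply: max_ge; lra.
lra.
Qed.

(** [T3] is harmless, and [T1] alone cannot outweigh the constant 1. The difficulty is [y < 2 * x],
    where [T2] may be negative too. The numerical margins below are those at [t = 0]. *)
Lemma third_max_gt (x y z : R) : 0 < x -> x < y -> y <= z ->
  - (t / 2) < D x y z.
Proof.
move=> x0 xy yz; have t_ge0 := t0.
eassert (6 * D x y z = _) as E by (apply: (gap_third_max gapD); lra).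
have T1 : - (2 / 3) <= D (2 * x) (y - x) z by apply: ge23; lra.
have T3 : - t <= D x (2 * y) (z - y) by apply: ge0; lra.
have [h|y2x] := leP (2 * x) y.
  by have T2 : - t <= D (2 * x) y (z - x); [apply: ge0|]; lra.
have [x2z|z2x] := leP (2 * x) z.
  have T1' : - (32 / 75 + t) <= D (2 * x) (y - x) z by apply: max_ge; lra.
  have [h|yzx] := ltP (z - x) y.
    by have T2 : - (7 / 15 + t) <= D (2 * x) y (z - x); [apply: min_ge|]; lra.
  have [h|zx2x] := leP (2 * x) (z - x).
    by have T2 : - (32 / 75 + t) <= D (2 * x) y (z - x);
      [apply: max_ge|]; lra.
  (* So far only 1 - 32/75 - 2/3 = -7/75 is guaranteed. A second round in [T3] gains 1/9, which is
     more than 7/75. *)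
  have T2 : - (2 / 3) <= D (2 * x) y (z - x) by apply: ge23; lra.
  eassert (6 * D x (2 * y) (z - y) = _) as E3
    by (apply: (gap_third_mid gapD); lra).
  have U1 : - (2 / 3) <= D (2 * x) (2 * y - x) (z - y) by apply: ge23; lra.
  have U2 : - t <= D (2 * x) (2 * y) (z - y - x) by apply: ge0; lra.
  have U3 : - (2 / 3) <= D x (2 * y - (z - y)) (2 * (z - y)).
    by apply: ge23; lra.
  lra.
(* When [z < 2 * x], [T1] leaves 1/3 to compensate for [T2]. The recursion wants the smaller stack
   first, hence the swap before expanding [T2]. *)
have A2 : D (2 * x) y (z - x) = _ := gap_anti gapD _ _ _.
eassert (6 * D y (2 * x) (z - x) = _) as E2
  by (apply: (gap_third_min gapD); lra).
have U1 : D (2 * y) (2 * x - y) (z - x) <= t by apply: le0; lra.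
(* If [z = y], then [T3] vanishes and [- T2] is at most 5/18 or 29/90, both below 1/3. *)
have [zy|yz'] := leP z y.
  have T3' : D x (2 * y) (z - y) = 0.
    by rewrite (_ : z - y = 0) ?(gap_third_ruined gapD); lra.
  have [h|h] := leP (3 * x) (2 * y).
    have U2 : D (y - (z - x)) (2 * x) (2 * (z - x)) <= 2 / 3.
      by apply: le23; lra.
    have U3 : D y (2 * x - (z - x)) (2 * (z - x)) <= t by apply: le0; lra.
    lra.
  have U2 : D (y - (z - x)) (2 * x) (2 * (z - x)) <= 7 / 15 + t.
    by apply: min_le; lra.
  have U3 : D y (2 * x - (z - x)) (2 * (z - x)) <= 7 / 15 + t.
    by apply: min_le; lra.
  lra.
(* Now [- T2] is only bounded by 7/18, which exceeds 1/3 by 1/18. Expanding [T3] gives at least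
   4/45, which covers this. *)
have U2 : D (y - (z - x)) (2 * x) (2 * (z - x)) <= 2 / 3 by apply: le23; lra.
have U3 : D y (2 * x - (z - x)) (2 * (z - x)) <= 2 / 3 by apply: le23; lra.
eassert (6 * D x (2 * y) (z - y) = _) as E3
  by (apply: (gap_third_min gapD); lra).
have V1 : - (7 / 15 + t) <= D (2 * x) (2 * y - x) (z - y).
  have [h|h] := leP (2 * x) (2 * y - x); last by apply: min_ge; lra.
  by have : - t <= D (2 * x) (2 * y - x) (z - y); [apply: ge0|]; lra.
have V2 : - t <= D (x - (z - y)) (2 * y) (2 * (z - y)) by apply: ge0; lra.
have V3 : - t <= D x (2 * y - (z - y)) (2 * (z - y)) by apply: ge0; lra.
lra.
Qed.

(** After [T1], a slack of 1/3 remains. Only [T3] can consume it, and only when [z - x < y]. Then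
    [T3], [T2] or both are expanded once more, again with margins at [t = 0]. *)
Lemma third_min_gt (x y z : R) : 0 < x -> x < y -> y < z -> - (t / 2) < D y z x.
Proof.
move=> x0 xy yz; have t_ge0 := t0.
eassert (6 * D y z x = _) as E by (apply: (gap_third_min gapD); lra).
have T1 : - (2 / 3) <= D (2 * y) (z - y) x by apply: ge23; lra.
have T2 : - t <= D (y - x) z (2 * x) by apply: ge0; lra.
have [h|zxy] := leP y (z - x).
  by have T3 : - t <= D y (z - x) (2 * x); [apply: ge0|]; lra.
have A3 : D y (z - x) (2 * x) = _ := gap_anti gapD _ _ _.
have [y2x|x2y] := leP y (2 * x).
  have [yzx|zxy2] := leP y (2 * (z - x)).
    eassert (6 * D (z - x) y (2 * x) = _) as E3
      by (apply: (gap_third_max gapD); lra).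
    have U1 : D (2 * (z - x)) (y - (z - x)) (2 * x) <= t by apply: le0; lra.
    have U2 : D (2 * (z - x)) y (2 * x - (z - x)) <= t by apply: le0; lra.
    have U3 : D (z - x) (2 * y) (2 * x - y) <= 2 / 3 by apply: le23; lra.
    lra.
  (* This overdraws the slack by 32/75 - 1/3 = 42/450. Expanding [T2] returns 1/9 if [2 * x < z] and
     43/450 otherwise, the narrowest margin of the proof. *)
  have T3 : D (z - x) y (2 * x) <= 32 / 75 + t by apply: max_le; lra.
  have V2 : - t <= D (2 * (y - x)) z (2 * x - (y - x)) by apply: ge0; lra.
  have [x2z|z2x] := ltP (2 * x) z.
    eassert (6 * D (y - x) z (2 * x) = _) as E2
      by (apply: (gap_third_mid gapD); lra).
    have V1 : - (2 / 3) <= D (2 * (y - x)) (z - (y - x)) (2 * x).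
      by apply: ge23; lra.
    have V3 : - (2 / 3) <= D (y - x) (z - 2 * x) (2 * (2 * x)).
      by apply: ge23; lra.
    lra.
  eassert (6 * D (y - x) z (2 * x) = _) as E2
    by (apply: (gap_third_max gapD); lra).
  have V1 : - (32 / 75 + t) <= D (2 * (y - x)) (z - (y - x)) (2 * x).
    have [h|h] := leP (2 * (y - x)) (z - (y - x)).
      by have : - t <= D (2 * (y - x)) (z - (y - x)) (2 * x);
        [apply: ge0|]; lra.
    by apply: max_ge; lra.
  have V3 : - t <= D (y - x) (2 * z) (2 * x - z) by apply: ge0; lra.
  lra.
have U1 : D (2 * (z - x)) (y - (z - x)) (2 * x) <= t by apply: le0; lra.
have U3 : D (z - x) (y - 2 * x) (2 * (2 * x)) <= t by apply: le0; lra.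
have [x3z|z3x] := ltP (3 * x) z.
  eassert (6 * D (z - x) y (2 * x) = _) as E3
    by (apply: (gap_third_min gapD); lra).
  have U2 : D (z - x - 2 * x) y (2 * (2 * x)) <= 2 / 3 by apply: le23; lra.
  lra.
(* The expansion of [T3] may use up the slack 1/3 exactly. Strictness comes from [T2], whose
   expansion is at least 1/25. *)
eassert (6 * D (z - x) y (2 * x) = _) as E3
  by (apply: (gap_third_mid gapD); lra).
have U2 : D (2 * (z - x)) y (2 * x - (z - x)) <= t by apply: le0; lra.
eassert (6 * D (y - x) z (2 * x) = _) as E2
  by (apply: (gap_third_mid gapD); lra).
have V1 : - (2 / 3) <= D (2 * (y - x)) (z - (y - x)) (2 * x).
  by apply: ge23; lra.
have V2 : - (2 / 3) <= D (2 * (y - x)) z (2 * x - (y - x)).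
  by apply: ge23; lra.
have V3 : - (32 / 75 + t) <= D (y - x) (z - 2 * x) (2 * (2 * x)).
  by apply: max_ge; lra.
lra.
Qed.

Lemma gap_gt (a b c : R) : 0 < a -> a < b -> 0 < c -> - (t / 2) < D a b c.
Proof.
move=> a0 ab c0.
have [bc|cb] := leP b c; first exact: third_max_gt.
have [ac|ca] := leP a c; first exact: third_mid_gt.
exact: third_min_gt.
Qed.

Lemma gap_bounds_half : gap_bounds D (t / 2).
Proof.
split; [|exact: third_max_le|exact: third_min_le].
move=> a b c a0; rewrite le_eqVlt => /predU1P[<-|ab] c0.
  by have t_ge0 := t0; have := gap_anti gapD a a c; lra.
exact/ltW/gap_gt.
Qed.

End Step.

Lemma gap_bounds0 : gap_bounds D 0.
Proof.
have bounds_pow n : gap_bounds D (2 / 3 / 2 ^+ n).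
  elim: n => [|n IH]; first by rewrite expr0 divr1; exact: gap_bounds_init.
  rewrite exprSr invfM mulrA; apply: gap_bounds_half => //.
have small (e : R) : 0 < e -> exists n, 2 / 3 / 2 ^+ n <= e.
  move=> e0; exists (Num.bound (2 / 3 / e)).
  rewrite ler_pdivrMr ?exprn_gt0// [leRHS]mulrC -ler_pdivrMr//.
  apply/ltW/(lt_le_trans (archi_boundP _)); first by rewrite !divr_ge0// ltW.
  by rewrite -natrX ler_nat ltnW// ltn_expl.
split=> a b c h1 h2 h3.
- rewrite -lerN2; apply/ler_addgt0Pr => e /small[n le_e].
  by have := gap_lower (bounds_pow n) h1 h2 h3; lra.
- apply/ler_addgt0Pr => e /small[n le_e].
  by have := gap_upper_third_max (bounds_pow n) h1 h2 h3; lra.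
- apply/ler_addgt0Pr => e /small[n le_e].
  by have := gap_upper_third_min (bounds_pow n) h1 h2 h3; lra.
Qed.

(** The limiting bounds are not strict. One more expansion at [t = 0] restores strictness. *)
Lemma gap_gt0 (a b c : R) : 0 < a -> a < b -> 0 < c -> 0 < D a b c.
Proof.
move=> a0 ab c0.
by have := gap_gt (lexx 0) gap_bounds0 a0 ab c0; rewrite mul0r oppr0.
Qed.

End GapBounds.

Lemma forall_ord3 (p : pred 'I_3) : [forall i, p i] = [&& p 0, p 1 & p 2%:R].
Proof.
apply/forallP/and3P => [p3|[p0 p1 p2] i]; first by split.
have [->|->|->] : [\/ i = 0, i = 1 | i = 2%:R] => //.
by case: i => -[|[|[|//]]] i3; [apply: Or31|apply: Or32|apply: Or33];
  apply/val_inj.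
Qed.

(** * Losing probabilities for a finite number of rounds *)

Section LoseWithin.
Context (R : realType).

(* The probability that the first player is eliminated first, and within [n]
   rounds. *)
Fixpoint lose_within (n : nat) (a b c : R) : R :=
  if n is n'.+1 then
    if [&& 0 < a, 0 < b & 0 < c] then
      let ab := Num.min a b in let ac := Num.min a c in let bc := Num.min b c in
      (lose_within n' (a + ab) (b - ab) c + lose_within n' (a - ab) (b + ab) c
       + lose_within n' (a + ac) b (c - ac) + lose_within n' (a - ac) b (c + ac)
       + lose_within n' a (b + bc) (c - bc) + lose_within n' a (b - bc) (c + bc))
      / 6
    else (a == 0)%:R
  else (a == 0)%:R.

Lemma lose_withinS n (a b c : R) : 0 < a -> 0 < b -> 0 < c ->
  let ab := Num.min a b in let ac := Num.min a c in let bc := Num.min b c in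
  6 * lose_within n.+1 a b c =
    lose_within n (a + ab) (b - ab) c + lose_within n (a - ab) (b + ab) c
    + lose_within n (a + ac) b (c - ac) + lose_within n (a - ac) b (c + ac)
    + lose_within n a (b + bc) (c - bc) + lose_within n a (b - bc) (c + bc).
Proof. by move=> a0 b0 c0 /=; rewrite a0 b0 c0 mulrC divfK. Qed.

Lemma lose_within_end n (a b c : R) : ~~ [&& 0 < a, 0 < b & 0 < c] ->
  lose_within n a b c = (a == 0)%:R.
Proof. by case: n => //= n /negbTE ->. Qed.

Lemma lose_within_ge0 n (a b c : R) : 0 <= lose_within n a b c.
Proof.
elim: n a b c => [|n IH] a b c /=; first by rewrite ler0n.
by case: ifP => _; rewrite ?ler0n// divr_ge0// !addr_ge0.
Qed.

Lemma lose_withinC n (a b c : R) : lose_within n a b c = lose_within n a c b.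
Proof.
elim: n a b c => [|n IH] a b c //=.
rewrite [(0 < b) && _]andbC; case: ifP => // _; congr (_ / 6).
rewrite [Num.min c b]minC (IH a (b + _)) (IH a (b - _)).
rewrite (IH (a + Num.min a b)) (IH (a - Num.min a b)).
rewrite (IH (a + Num.min a c)) (IH (a - Num.min a c)).
lra.
Qed.

Lemma lose_within_ruined n (b c : R) : lose_within n 0 b c = 1.
Proof. by rewrite lose_within_end ?ltxx ?eqxx. Qed.

Lemma lose_within_ruined2 n (a c : R) : 0 < a -> lose_within n a 0 c = 0.
Proof. by move=> a0; rewrite lose_within_end ?ltxx ?andbF// gt_eqF. Qed.

Lemma lose_within_ruined3 n (a b : R) : 0 < a -> lose_within n a b 0 = 0.
Proof. by move=> a0; rewrite lose_withinC lose_within_ruined2. Qed.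

(* At most two of the six outcomes of a round eliminate the first player, and
   each of the three pairs has an outcome that ends the game; hence the
   supremum [p] satisfies [p <= (2 + 3 p) / 6]. *)
Lemma lose_within_le n (a b c : R) : 0 < a -> 0 <= b -> 0 <= c ->
  lose_within n a b c <= 2 / 3.
Proof.
elim: n a b c => [|n IH] a b c a0 b0 c0; first by rewrite /= gt_eqF// divr_ge0.
move: b0; rewrite le_eqVlt => /predU1P[<-|b0].
  by rewrite lose_within_ruined2//; lra.
move: c0; rewrite le_eqVlt => /predU1P[<-|c0].
  by rewrite lose_within_ruined3//; lra.
suff half1 (u v w : R) : 0 < u -> 0 < v -> 0 < w ->
    lose_within n (u + Num.min u v) (v - Num.min u v) w
    + lose_within n (u - Num.min u v) (v + Num.min u v) w <= 5 / 3.
  have half2 : lose_within n a (b + Num.min b c) (c - Num.min b c)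
      + lose_within n a (b - Num.min b c) (c + Num.min b c) <= 2 / 3.
    case: (leP b c) => h; rewrite subrr.
      by rewrite lose_within_ruined2// addr0; apply: IH; lra.
    by rewrite lose_within_ruined3// add0r; apply: IH; lra.
  have E := lose_withinS n a0 b0 c0.
  have hb := half1 _ _ _ a0 b0 c0.
  have hc := half1 _ _ _ a0 c0 b0.
  move: E hc => /=.
  rewrite (lose_withinC n (a + Num.min a c)) (lose_withinC n (a - Num.min a c)).
  lra.
move=> u0 v0 w0; case: (leP u v) => h; rewrite subrr.
  rewrite lose_within_ruined.
  by have := IH (u + u) (v - u) w; lra.
rewrite lose_within_ruined2; last by lra.
by have := IH (u - v) (v + v) w; lra.
Qed.

End LoseWithin.

(** * First-round analysis of the random process *)

Section Rounds.
Context (R : realType) d (T : measurableType d).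
Implicit Types (pr : nat -> T -> 'I_3) (co : nat -> T -> bool).

Definition shift (A : Type) (u : nat -> A) : nat -> A := fun n => u n.+1.

Definition lost_within pr co n (s : 'I_3 -> R) : set T :=
  [set w | exists k, [/\ (k <= n)%N, stack_process pr co s k w ord0 = 0 &
    forall j, (j < k)%N -> forall i, 0 < stack_process pr co s j w i]].

Lemma is_loserE pr co (s : 'I_3 -> R) :
  is_loser pr co s ord0 = \bigcup_n lost_within pr co n s.
Proof.
apply/seteqP; split=> [w [n [n0 pos]]|w [n _ [k [_ k0 pos]]]].
  by exists n => //; exists n.
by exists k.
Qed.

Lemma lost_within_nondecreasing pr co (s : 'I_3 -> R) :
  nondecreasing_seq (fun n => lost_within pr co n s).
Proof.
move=> m n mn; apply/subsetPset => w [k [km k0 pos]].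
by exists k; split => //; exact: leq_trans mn.
Qed.

(** [stack_process] appends rounds at the end, whereas conditioning on the first round requires
    splitting off the initial one. *)
Lemma stack_processSr pr co (s : 'I_3 -> R) n w :
  stack_process pr co s n.+1 w =
  stack_process (shift pr) (shift co) (play_round (pr 0%N w) (co 0%N w) s) n w.
Proof. by elim: n => //= n <-. Qed.

Lemma lost_withinS pr co n (s : 'I_3 -> R) : (forall i, 0 < s i) ->
  lost_within pr co n.+1 s = [set w | lost_within (shift pr) (shift co) n
    (play_round (pr 0%N w) (co 0%N w) s) w].
Proof.
move=> s0; apply/seteqP; split=> w.
  move=> [[|k] [kn k0 pos]]; first by have := s0 ord0; rewrite -k0 ltxx.
  exists k; rewrite -stack_processSr; split => // j jk i.
  by rewrite -stack_processSr; apply: pos.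
move=> [k [kn k0 pos]]; exists k.+1; rewrite stack_processSr; split=> //.
by move=> [_|j jk] i; [exact: s0|rewrite stack_processSr; apply: pos].
Qed.

(** Only the witness [k = 0] is possible, so the initial stacks decide the event. *)
Lemma lost_within_stop pr co n (s : 'I_3 -> R) :
  (n == 0)%N || ~~ [forall i, 0 < s i] ->
  lost_within pr co n s = if s ord0 == 0 then setT else set0.
Proof.
move=> stop; apply/seteqP; split=> w.
  move=> [[|k] [kn /= k0 pos]]; first by rewrite k0 eqxx.
  move: stop; rewrite -leqn0 leqNgt (leq_ltn_trans _ kn)//= => /negP[].
  by apply/forallP => i; have := pos 0%N isT i.
by case: eqP => // s0 _; exists 0%N.
Qed.

(** A cylinder event. The default of [nth] is never read, since [k < size h]. *)
Definition outcomes pr co (h : seq ('I_3 * bool)) : set T :=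
  [set w | forall k, (k < size h)%N -> (pr k w, co k w) = nth (ord0, true) h k].

(* Conditioning on the first outcome preserves this property for the shifted
   rounds, which gives the recursion for the probability to lose within [n]
   rounds without any Markov property of the infinite process. *)
Definition fair_given (P : probability T R) (C : set T) pr co : Prop :=
  forall h, P (C `&` outcomes pr co h) = (P C * (6 ^- size h)%:E)%E.

Lemma outcomes_cons pr co x h : outcomes pr co (x :: h) =
  [set w | (pr 0%N w, co 0%N w) = x] `&` outcomes (shift pr) (shift co) h.
Proof.
apply/seteqP; split=> [w hw|w [w0 hw] [|k] kh //].
  by split=> [|k kh]; [exact: (hw 0%N)|exact: (hw k.+1)].
exact: (hw k).
Qed.

Lemma outcomes_nil pr co : outcomes pr co [::] = setT.
Proof. by apply/seteqP; split. Qed.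

(** The histories [[:: x]] and [x :: h] give the two claims, as 6 to the power of minus the length
    is multiplicative. *)
Lemma fair_given_cons (P : probability T R) C pr co x :
  fair_given P C pr co ->
  P (C `&` [set w | (pr 0%N w, co 0%N w) = x]) = (P C * (6^-1)%:E)%E /\
  fair_given P (C `&` [set w | (pr 0%N w, co 0%N w) = x]) (shift pr) (shift co).
Proof.
move=> fC.
have PCx : P (C `&` [set w | (pr 0%N w, co 0%N w) = x]) = (P C * (6^-1)%:E)%E.
  by have := fC [:: x]; rewrite outcomes_cons outcomes_nil setIT /= expr1.
split=> // h; rewrite PCx -setIA -outcomes_cons fC /= -muleA -EFinM.
by rewrite exprS invfM.
Qed.

Lemma preimage_partition (I : Type) (g : T -> I) (A : set T) :
  A = \bigcup_i (A `&` g @^-1` [set i]).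
Proof.
rewrite -setI_bigcupr.
by apply/seteqP; split=> [w Aw|w []//]; split=> //; exists (g w).
Qed.

Lemma measurable_partition_fin (I : finType) (g : T -> I) (A : set T) :
  (forall i, measurable (A `&` g @^-1` [set i])) -> measurable A.
Proof.
move=> mA; rewrite (preimage_partition g A).
by apply: fin_bigcup_measurable; [exact: finite_finset|move=> i _; exact: mA].
Qed.

Lemma measure_partition_fin (P : probability T R) (I : finType) (g : T -> I)
    (A : set T) : (forall i, measurable (A `&` g @^-1` [set i])) ->
  P A = (\sum_(i : I) P (A `&` g @^-1` [set i]))%E.
Proof.
move=> mA; rewrite {1}(preimage_partition g A) measure_fin_bigcup//.
- rewrite [RHS](fsbig_seq _ _ (index_enum_uniq I)); apply: eq_fsbigl.
  by apply/seteqP; split=> // i _; exact: mem_index_enum.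
- exact: finite_finset.
- by move=> i j _ _ [w [[_ /= <-] [_ /= <-]]].
Qed.

Definition measurable_rounds pr co : Prop :=
  forall n x, measurable [set w | (pr n w, co n w) = x].

(** Once the first outcome is fixed, the stacks after the first round are deterministic, so the
    recursion applies to a fixed state. *)
Lemma lost_within_cell pr co n (s : 'I_3 -> R) x : (forall i, 0 < s i) ->
  lost_within pr co n.+1 s `&` [set w | (pr 0%N w, co 0%N w) = x] =
  [set w | (pr 0%N w, co 0%N w) = x] `&`
    lost_within (shift pr) (shift co) n (play_round x.1 x.2 s).
Proof.
move=> s0; rewrite lost_withinS//.
by apply/seteqP; split=> w [] => [+ <-|<-].
Qed.

Lemma measurable_lost_within pr co n (s : 'I_3 -> R) :
  measurable_rounds pr co -> measurable (lost_within pr co n s).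
Proof.
elim: n pr co s => [|n IH] pr co s mr.
  by rewrite lost_within_stop//; case: ifP.
have [/forallP s0|stop] := boolP [forall i, 0 < s i]; last first.
  by rewrite lost_within_stop ?stop ?orbT//; case: ifP.
apply: (measurable_partition_fin (g := fun w => (pr 0%N w, co 0%N w))) => x.
rewrite lost_within_cell//; apply: measurableI; first exact: mr.
by apply: IH => k y; exact: mr.
Qed.

Lemma sum_play_round (G : R -> R -> R -> R) (s : 'I_3 -> R) :
  let a := s 0 in let b := s 1 in let c := s 2%:R in
  let ab := Num.min a b in let ac := Num.min a c in let bc := Num.min b c in
  \sum_(x : 'I_3 * bool) (let s' := play_round x.1 x.2 s in
    G (s' 0) (s' 1) (s' 2%:R)) =
  G (a + ab) (b - ab) c + G (a - ab) (b + ab) c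
  + G (a + ac) b (c - ac) + G (a - ac) b (c + ac)
  + G a (b + bc) (c - bc) + G a (b - bc) (c + bc).
Proof.
move=> a b c ab ac bc.
rewrite -(pair_bigA _ (fun i h => let s' := play_round i h s in
  G (s' 0) (s' 1) (s' 2%:R)))/=.
rewrite !big_ord_recl big_ord0 addr0.
have -> : lift ord0 ord0 = 1 :> 'I_3 by apply/val_inj.
have -> : lift ord0 (lift ord0 ord0) = 2%:R :> 'I_3 by apply/val_inj.
have -> : ord0 = 0 :> 'I_3 by apply/val_inj.
rewrite !big_bool /= /play_round /bet.
have -> : 0 + 1 = 1 :> 'I_3 by apply/val_inj.
have -> : 1 + 1 = 2%:R :> 'I_3 by apply/val_inj.
(* Addition wraps around, so the third pair consists of the last and the first player. *)
have -> : 2%:R + 1 = 0 :> 'I_3 by apply/val_inj.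
rewrite !eqxx.
have -> : (0 == 1 :> 'I_3) = false by [].
have -> : (1 == 0 :> 'I_3) = false by [].
have -> : (0 == 2%:R :> 'I_3) = false by [].
have -> : (2%:R == 0 :> 'I_3) = false by [].
have -> : (1 == 2%:R :> 'I_3) = false by [].
have -> : (2%:R == 1 :> 'I_3) = false by [].
rewrite -/a -/b -/c [Num.min b a]minC [Num.min c a]minC [Num.min c b]minC.
rewrite -/ab -/ac -/bc.
lra.
Qed.

(** The event [C] and the round sequences vary in the induction: the first outcome is absorbed into
    [C] and the rounds are shifted. *)
Lemma prob_lost_within (P : probability T R) C pr co n (s : 'I_3 -> R) :
  measurable_rounds pr co -> measurable C -> fair_given P C pr co ->
  P (C `&` lost_within pr co n s) =
    (P C * (lose_within n (s 0) (s 1) (s 2%:R))%:E)%E.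
Proof.
elim: n C pr co s => [|n IH] C pr co s mr mC fC.
  rewrite lost_within_stop//=.
  by case: eqP; rewrite ?setIT ?setI0 ?mule1 ?measure0 ?mule0.
have s_forall := forall_ord3 (fun i => 0 < s i).
have [/forallP s0|stop] := boolP [forall i, 0 < s i]; last first.
  rewrite lost_within_stop ?stop ?orbT// lose_within_end -?s_forall//.
  by case: eqP; rewrite ?setIT ?setI0 ?mule1 ?measure0 ?mule0.
have mcell x : measurable (C `&` [set w | (pr 0%N w, co 0%N w) = x]).
  by apply: measurableI => //; exact: mr.
have mr' : measurable_rounds (shift pr) (shift co) by move=> k; exact: mr.
have cellE x : C `&` lost_within pr co n.+1 s `&`
    (fun w => (pr 0%N w, co 0%N w)) @^-1` [set x] =
    C `&` [set w | (pr 0%N w, co 0%N w) = x] `&`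
    lost_within (shift pr) (shift co) n (play_round x.1 x.2 s).
  by rewrite -setIA lost_within_cell// setIA.
rewrite (@measure_partition_fin P _ (fun w => (pr 0%N w, co 0%N w)));
  last first.
  move=> x; rewrite cellE.
  by apply: measurableI; [exact: mcell|exact: measurable_lost_within].
under eq_bigr => x _.
  rewrite cellE; have [PCx fCx] := fair_given_cons x fC.
  rewrite IH// PCx.
  over.
have -> : lose_within n.+1 (s 0) (s 1) (s 2%:R) =
    6^-1 * \sum_(x : 'I_3 * bool) (let s' := play_round x.1 x.2 s in
      lose_within n (s' 0) (s' 1) (s' 2%:R)).
  by rewrite sum_play_round -lose_withinS ?mulKf.
rewrite -(fineK (fin_num_measure P _ mC)).
under eq_bigr do rewrite -!EFinM.
by rewrite sumEFin -mulr_sumr -EFinM mulrA.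
Qed.

End Rounds.

(** * The recursion for the actual losing probability *)

Section FairRounds.
Context (R : realType) d (T : measurableType d) (P : probability T R).
Context (pair : nat -> T -> 'I_3) (coin : nat -> T -> bool).
Context (fair : fair_rounds P pair coin).

Lemma fair_rounds_measurable : measurable_rounds pair coin.
Proof.
move=> n [i h].
have -> : [set w | (pair n w, coin n w) = (i, h)] =
    pair n @^-1` [set i] `&` coin n @^-1` [set h].
  by apply/seteqP; split=> w /=; [move=> [-> ->]|move=> [-> ->]].
apply: measurableI; [exact: (measurable_pair fair)|].
exact: (measurable_coin fair).
Qed.

(** A cylinder of length [N] is an intersection of [N] pair events and [N] coin events. By
    independence its probability is the product of [N] factors 1/3 and [N] factors 1/2. *)
Lemma fair_rounds_given : fair_given P setT pair coin.
Proof.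
move=> h; rewrite setTI probability_setT mul1e.
pose N := size h; pose out := nth (ord0, true) h.
pose s := map inl (iota 0 N) ++ map inr (iota 0 N) : seq (nat + nat).
have s_uniq : uniq s.
  rewrite cat_uniq !map_inj_uniq ?iota_uniq//= ?andbT; try by move=> ? ? [].
  by apply/hasPn => _ /mapP[k _ ->]; apply/mapP => -[].
pose E k : set T := match k with
  | inl n => pair n @^-1` [set (out n).1]
  | inr n => coin n @^-1` [set (out n).2]
  end.
have memJ k : (k \in [fset x in s]%fset) = (k \in s).
  by rewrite in_fset.
have -> : outcomes pair coin h = \bigcap_(k in [set` [fset x in s]%fset]) E k.
  apply/seteqP; split=> w hw.
    move=> k; rewrite /= memJ mem_cat => /orP[] /mapP[n];
      by rewrite mem_iota => /andP[_ /hw out_n] -> /=; rewrite /out -out_n.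
  move=> n nN; rewrite [RHS]surjective_pairing; congr (_, _).
    apply: (hw (inl n)); rewrite /= memJ mem_cat map_f//.
    by rewrite mem_iota.
  apply: (hw (inr n)); rewrite /= memJ mem_cat orbC map_f//.
  by rewrite mem_iota.
rewrite (independent_rounds fair); last first.
  by move=> [n|n] _; [exists [set (out n).1]|exists [set (out n).2]];
    rewrite ?setTI.
have -> : (\prod_(k <- [fset x in s]%fset) P (E k) = \prod_(k <- s) P (E k))%E.
  by apply: perm_big; apply: uniq_perm.
rewrite big_cat !big_map/=.
under eq_bigr do rewrite (uniform_pair fair).
under [X in (_ * X)%E]eq_bigr do rewrite (fair_coin fair).
rewrite !prodEFin -EFinM !big_const_seq !count_predT size_iota.
by rewrite !iter_mulr_1 -exprMn -invfM -exprVn -natrM.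
Qed.

(** Continuity of [P] from below along the increasing events [lost_within]. *)
Lemma lose_prob_cvg (a b c : R) :
  (lose_within n a b c)%:E @[n --> \oo] --> lose_prob P pair coin a b c.
Proof.
have mr := fair_rounds_measurable.
rewrite /lose_prob is_loserE.
have -> : (fun n => (lose_within n a b c)%:E) =
    P \o (fun n => lost_within pair coin n (stacks a b c)).
  apply/funext => n /=; rewrite -[X in P X]setTI.
  rewrite (prob_lost_within _ _ mr)//; last exact: fair_rounds_given.
  by rewrite probability_setT mul1e.
have mlost n : measurable (lost_within pair coin n (stacks a b c)).
  exact: measurable_lost_within.
apply: nondecreasing_cvg_mu => //; first exact: bigcupT_measurable.
exact: lost_within_nondecreasing.
Qed.

Let F (a b c : R) : R := fine (lose_prob P pair coin a b c).

Lemma lose_probE (a b c : R) : lose_prob P pair coin a b c = (F a b c)%:E.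
Proof.
rewrite fineK// /lose_prob is_loserE; apply: fin_num_measure.
apply: bigcupT_measurable => n.
exact: measurable_lost_within fair_rounds_measurable.
Qed.

Lemma lose_within_cvg (a b c : R) :
  lose_within n a b c @[n --> \oo] --> F a b c.
Proof.
by have := @lose_prob_cvg a b c; rewrite lose_probE => /fine_cvg.
Qed.

Lemma lose_prob_lim (a b c x : R) (u : nat -> R) :
  (forall n, lose_within n a b c = u n) -> u n @[n --> \oo] --> x ->
  F a b c = x.
Proof.
move=> /funext uE; apply: norm_cvg_unique; rewrite -uE.
exact: lose_within_cvg.
Qed.

Lemma lose_probC (a b c : R) :
  lose_prob P pair coin a b c = lose_prob P pair coin a c b.
Proof.
rewrite !lose_probE; congr _%:E.
by apply: lose_prob_lim (@lose_within_cvg a c b) => n; exact: lose_withinC.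
Qed.

Lemma lose_prob_const (a b c x : R) :
  (forall n, lose_within n a b c = x) -> F a b c = x.
Proof. by move=> Ex; apply: (lose_prob_lim Ex); exact: cvg_cst. Qed.

Lemma lose_prob_bounds (a b c : R) : 0 < a -> 0 <= b -> 0 <= c ->
  0 <= F a b c <= 2 / 3.
Proof.
move=> a0 b0 c0; apply/andP; split.
  apply: (cvgr_to_ge (@lose_within_cvg a b c)).
  by apply: nearW => n; exact: lose_within_ge0.
apply: (cvgr_to_le (@lose_within_cvg a b c)).
by apply: nearW => n; exact: lose_within_le.
Qed.

Lemma lose_prob_step (a b c : R) : 0 < a -> 0 < b -> 0 < c ->
  let ab := Num.min a b in let ac := Num.min a c in let bc := Num.min b c in
  6 * F a b c =
    F (a + ab) (b - ab) c + F (a - ab) (b + ab) c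
    + F (a + ac) b (c - ac) + F (a - ac) b (c + ac)
    + F a (b + bc) (c - bc) + F a (b - bc) (c + bc).
Proof.
move=> a0 b0 c0 ab ac bc.
(* The horizon is [n.+1] on the left of the recursion and [n] on the right. The shift does not
   change the limit. *)
have cvgF : 6 * lose_within n.+1 a b c @[n --> \oo] --> 6 * F a b c.
  have := @lose_within_cvg a b c; rewrite -cvg_shiftS; exact: cvgMl_tmp.
apply: norm_cvg_unique cvgF _.
have -> : (fun n => 6 * lose_within n.+1 a b c) = (fun n =>
    lose_within n (a + ab) (b - ab) c + lose_within n (a - ab) (b + ab) c
    + lose_within n (a + ac) b (c - ac) + lose_within n (a - ac) b (c + ac)
    + lose_within n a (b + bc) (c - bc) + lose_within n a (b - bc) (c + bc)).
  by apply/funext => n; exact: lose_withinS.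
by do ?apply: cvgD; exact: lose_within_cvg.
Qed.

(** The recursions of [F a b c] and [F b a c] are subtracted. Ruin of the first, second or third
    player contributes 1, -1 or 0, so the constants are 1 + 1 - 1, 1 + 1 + 0 and 1 + 0 + 0. *)
Lemma lose_prob_gap : ruin_gap (fun a b c => F a b c - F b a c).
Proof.
have F1 b c : F 0 b c = 1.
  by apply: lose_prob_const => n; exact: lose_within_ruined.
have F2 a c : 0 < a -> F a 0 c = 0.
  by move=> a0; apply: lose_prob_const => n; exact: lose_within_ruined2.
have F3 a b : 0 < a -> F a b 0 = 0.
  by move=> a0; apply: lose_prob_const => n; exact: lose_within_ruined3.
have twice (a : R) : 2 * a = a + a by rewrite mulr_natl mulr2n.
split=> [a b c|b c b0 c0|a b a0 b0|a b c a0 b0 c0|a b c a0 ab bc|a b c a0 ac cb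
  |a b c c0 ca ab].
- by rewrite opprB.
- by rewrite F1 F2// subr0.
- by rewrite !F3// subr0.
- have /andP[_ h1] := lose_prob_bounds a0 (ltW b0) c0.
  have /andP[h2 _] := lose_prob_bounds b0 (ltW a0) c0.
  lra.
- have b0 := lt_le_trans a0 ab; have c0 := lt_le_trans b0 bc.
  have ac := le_trans ab bc.
  have := lose_prob_step a0 b0 c0; have := lose_prob_step b0 a0 c0.
  rewrite [Num.min b a]minC (min_l ab) (min_l ac) (min_l bc) /=.
  rewrite !subrr !F1 !F2 ?addr_gt0// !twice.
  lra.
- have c0 := lt_le_trans a0 ac; have b0 := lt_le_trans c0 cb.
  have ab := le_trans ac cb.
  have := lose_prob_step a0 b0 c0; have := lose_prob_step b0 a0 c0.
  rewrite [Num.min b a]minC (min_l ab) (min_l ac) (min_r cb) /=.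
  rewrite !subrr !F1 !F3 ?F2 ?addr_gt0// !twice.
  lra.
- have a0 := lt_le_trans c0 ca; have b0 := lt_le_trans a0 ab.
  have cb := le_trans ca ab.
  have := lose_prob_step a0 b0 c0; have := lose_prob_step b0 a0 c0.
  rewrite [Num.min b a]minC (min_l ab) (min_r ca) (min_r cb) /=.
  rewrite !subrr !F1 !F3 ?F2 ?addr_gt0// !twice.
  lra.
Qed.

Lemma lose_prob_lt (a b c : R) : 0 < a -> a < b -> 0 < c ->
  (lose_prob P pair coin b a c < lose_prob P pair coin a b c)%E.
Proof.
by move=> a0 ab c0; rewrite !lose_probE lte_fin -subr_gt0;
  exact: gap_gt0 lose_prob_gap _ _ _ a0 ab c0.
Qed.

End FairRounds.

Theorem theorem1 (R : realType) (d : measure_display) (T : measurableType d)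
    (P : probability T R)
    (pair : nat -> T -> 'I_3) (coin : nat -> T -> bool)
    (hrounds : fair_rounds P pair coin)
    (x y z : R) (hx : 0 < x) (hxy : x < y) (hyz : y < z) :
  let f := lose_prob P pair coin in
  ((f x y z > f y x z)%E /\ (f y x z > f z x y)%E) /\
  (forall a b c : R, perm_eq [:: a; b; c] [:: x; y; z] ->
    (a < b -> (f b a c < f a b c)%E) /\
    (a < c -> (f c b a < f a b c)%E)).
Proof.
move=> f; have fC := lose_probC hrounds.
have y0 := lt_trans hx hxy; have z0 := lt_trans y0 hyz.
have f_lt a b c : 0 < a -> 0 < b -> 0 < c ->
    (a < b -> (f b a c < f a b c)%E) /\ (a < c -> (f c b a < f a b c)%E).
  move=> a0 b0 c0; split=> ltab; first exact: lose_prob_lt.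
  (* Symmetry in the last two stacks turns an exchange with the third player into one with the
     second. *)
  by rewrite /f [ltLHS]fC [ltRHS]fC; exact: lose_prob_lt.
split.
  split; first exact: proj1 (f_lt x y z hx y0 z0) hxy.
  by rewrite /f [ltLHS]fC [ltRHS]fC; exact: proj1 (f_lt y z x y0 z0 hx) hyz.
move=> a b c /perm_mem abc.
have pos u : u \in [:: a; b; c] -> 0 < u.
  by rewrite abc !inE => /or3P[] /eqP ->.
by apply: f_lt; apply: pos; rewrite !inE eqxx ?orbT.
Qed.
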